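(* Let $\Gamma$ be a finite group and let $(X,T)$ be a free $\Gamma$-dynamical system. Then $$\dim(X,T)=\frac{1}{|\Gamma|}\dim(X),$$ where $\dim(X)$ is the Lebesgue covering dimension of $X$.
   Context: A $\Gamma$-dynamical system $(X,T)$ is a compact metric space $X$ with a homomorphism $T$, $\gamma\mapsto T_\gamma$, from $\Gamma$ to the group of self-homeomorphisms of $X$. It is free if $T_\gamma(x)\neq T_{\gamma'}(x)$ for every $x\in X$ and all distinct $\gamma,\gamma'\in\Gamma$. $\mathrm{Prob}(X,T)$ is the set of $T$-invariant Borel probability measures on $X$. $\mathrm{Cov}(X)$ is the set of finite open covers of $X$; $\mathcal{V}\succeq\mathcal{U}$ means every $V\in\mathcal{V}$ is contained in some $U\in\mathcal{U}$; $\mathrm{ord}(\mathcal{V},x)=-1+\sum_{V\in\mathcal{V}}\mathbf{1}_V(x)$; and $$\dim(X,T)=\sup_{\mathcal{U}\in\mathrm{Cov}(X)}\ \inf_{\mathcal{V}\in\mathrm{Cov}(X),\,\mathcal{V}\succeq\mathcal{U}}\ \sup_{\mu\in\mathrm{Prob}(X,T)}\int_X \mathrm{ord}(\mathcal{V},x)\,d\mu(x)\in[0,+\infty],$$ with $\dim(X,T)=-\infty$ if $\mathrm{Prob}(X,T)=\emptyset$. The Lebesgue covering dimension is $\dim(X)=\sup_{\mathcal{U}\in\mathrm{Cov}(X)}\inf_{\mathcal{V}\in\mathrm{Cov}(X),\,\mathcal{V}\succeq\mathcal{U}}\sup_{x\in X}\mathrm{ord}(\mathcal{V},x)$, with $\dim(\emptyset)=-\infty$.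 *)

(* Defs.v *)
From HB Require Import structures.
From mathcomp Require Import all_boot all_order all_algebra all_fingroup.
From mathcomp Require Import all_classical all_reals all_analysis.

Set Implicit Arguments.
Unset Strict Implicit.
Unset Printing Implicit Defensive.

Import Order.TTheory GRing.Theory Num.Theory.

Local Open Scope classical_set_scope.
Local Open Scope ring_scope.
Local Open Scope ereal_scope.

Definition homeomorphism (X : topologicalType) (f : X -> X) : Prop :=
  continuous f /\
  exists g : X -> X, [/\ continuous g, cancel f g & cancel g f].

(* A homomorphism from Gamma to the group (under composition) of
   self-homeomorphisms of X. Preservation of the unit follows. *)
Record dynamical_system (Gamma : groupType) (X : topologicalType) := DynSys {
  dyn_act :> Gamma -> X -> X ;
  dyn_homeo : forall g, homeomorphism (dyn_act g) ;
  dyn_actM : forall g h, dyn_act (g * h)%g = dyn_act g \o dyn_act h }.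

Definition free_system (Gamma : groupType) (X : topologicalType)
    (T : dynamical_system Gamma X) : Prop :=
  forall (x : X) (g h : Gamma), g <> h -> T g x <> T h x.

(* Borel probability measures. Measurable types are pointed in the library,
   whereas X may be empty here, so a Borel probability measure is packaged with
   a base point, which only serves to build the measurable structure: the
   sigma-algebra, the measure of a set and the integrals do not depend on it.
   When X is empty there is none, as it should be. *)

Definition pointed_at (X : topologicalType) (x0 : X) : Type := X.

HB.instance Definition _ (X : topologicalType) (x0 : X) :=
  Choice.on (pointed_at x0).
HB.instance Definition _ (X : topologicalType) (x0 : X) :=
  isPointed.Build (pointed_at x0) x0.

Notation borel_type x0 :=
  (g_sigma_algebraType (open : set (set (pointed_at x0)))).

Record borel_prob (R : realType) (X : topologicalType) := BorelProb {
  bp_base : X ;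
  bp_meas :> probability (borel_type bp_base) R }.

Definition bp_integral (R : realType) (X : topologicalType)
    (mu : borel_prob R X) (f : X -> \bar R) : \bar R :=
  \int[bp_meas mu]_(x in [set: borel_type (bp_base mu)]) f x.

Definition invariant_probs (R : realType) (Gamma : groupType)
    (X : topologicalType) (T : dynamical_system Gamma X) :
    set (borel_prob R X) :=
  [set mu | forall (g : Gamma) (A : set (borel_type (bp_base mu))),
     measurable A -> mu (T g @^-1` A) = mu A].

Arguments invariant_probs R {Gamma X} T.

Definition finite_open_cover (X : topologicalType) : set (set (set X)) :=
  [set UU | [/\ finite_set UU, (forall U, UU U -> open U)
    & \bigcup_(U in UU) U = [set: X]]].

Definition refines (X : Type) (VV UU : set (set X)) : Prop :=
  forall V, VV V -> exists2 U, UU U & V `<=` U.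

Definition cover_ord (R : realType) (X : topologicalType)
    (VV : set (set X)) (x : X) : R :=
  (-1 + \sum_(V \in VV) (\1_V x : R))%R.

Definition sup_inf_covers (R : realType) (X : topologicalType)
    (F : set (set X) -> \bar R) : \bar R :=
  ereal_sup [set ereal_inf [set F VV | VV in
    [set VV | finite_open_cover VV /\ refines VV UU]]
    | UU in @finite_open_cover X].

Definition dyn_dim (R : realType) (Gamma : groupType) (X : topologicalType)
    (T : dynamical_system Gamma X) : \bar R :=
  if `[< invariant_probs R T !=set0 >] then
    sup_inf_covers (fun VV => ereal_sup
      [set bp_integral mu (fun x => (cover_ord R VV x)%:E)
        | mu in invariant_probs R T])
  else -oo.

Definition covering_dim (R : realType) (X : topologicalType) : \bar R :=
  if `[< [set: X] !=set0 >] then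
    sup_inf_covers (fun VV => ereal_sup
      [set (cover_ord R VV x)%:E | x in [set: X] ])
  else -oo.

(* Main.v *)
From HB Require Import structures.
Require Import Defs.
From mathcomp Require Import all_boot all_order all_algebra all_fingroup.
From mathcomp Require Import all_classical all_reals all_analysis.
From mathcomp Require Import measurable_realfun.
From mathcomp Require Import lra zify.

(** For a cover VV, averaging over orbits shows that the supremum of the
    integrals of ord(VV, x) against invariant probabilities is 1 / |Gamma| times
    the supremum over x of the orbit sum of ord(VV, T_g x): one inequality is
    invariance, the other is the uniform probability on the orbit of x.  So
    (dyn_dimE) the theorem says that orbit sums of ord, optimised over covers,
    give dim X.  Two constructions of covers prove this.

    From orbit sums to dim X (max_ord_le_orbit).  The translates of a cover by
    the group elements must have a common refinement whose order is at most the
    sum of their orders.  Nerves explain it: a product of simplices is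
    triangulated without raising the dimension by the staircase triangulation.
    Concretely, bump functions of a cover, stacked one after the other, cut a
    half line into consecutive intervals depending on x; the refinement consists
    of the sets where the i-th interval of one cover meets the j-th interval of
    another (common_refinement2).  The pairs that meet form a chain, whence the
    bound on their number (card_overlap).

    From dim X to orbit sums (orbit_le_max_ord).  Let dim X be at most n.  First,
    every cover has a refinement by all the translates of sets W_k, each
    disjoint from its own translates, with at most n + 1 of them through any
    point (equivariant_cover).  This is the proof of the finite sum theorem of
    dimension theory: X is covered by finitely many closed sets B inside open
    sets disjoint from their translates; on the orbit of one such B the family
    can be shrunk using a small cover of order n taken near B only and carried
    along by the group, and shrinking does not damage the earlier steps.

    Next, this family is perturbed to general position (generic_cover).  With
    bump functions F_p of the members of the family, let V_p be the set where
    exp(l_p) F_p nearly realises the maximum of all exp(l_q) F_q, for widely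
    spread constants l_p.  When T_g x lies in V_p, a point depending on g only
    and a point depending on a translated index, of the form ln F_q(x), are at
    distance about l_p on the real line.  At most |Gamma| + n + 1 points are
    involved, so they have at most |Gamma| + n gaps; distances of distinct
    scales must contain distinct gaps of the corresponding scales
    (card_scaled_edges), so there are at most |Gamma| + n pairs (g, p) with T_g x
    in V_p, which says that the orbit sum of ord(V, T_g x) is at most n. *)

Set Implicit Arguments.
Unset Strict Implicit.
Unset Printing Implicit Defensive.

Import Order.TTheory GRing.Theory Num.Theory.
Import numFieldNormedType.Exports.

Local Open Scope classical_set_scope.
Local Open Scope ring_scope.

(** * Overlaps of two subdivisions of a half line *)

Section Staircase.
Variable R : realType.

(** Nonnegative numbers [f i] are laid end to end from 0, in the order of the
    enumeration of [I]: [i] occupies the interval from [lower_end f i] to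
    [upper_end f i]. *)
Definition lower_end (I : finType) (f : I -> R) (i : I) : R :=
  \sum_(i' : I | (enum_rank i' < enum_rank i)%N) f i'.

Definition upper_end (I : finType) (f : I -> R) (i : I) : R :=
  lower_end f i + f i.

Lemma upper_end_le (I : finType) (f : I -> R) (i j : I) :
  (forall k, 0 <= f k) -> (enum_rank i < enum_rank j)%N ->
  upper_end f i <= lower_end f j.
Proof.
move=> f0 ij; rewrite /upper_end [lower_end f j]/lower_end (bigD1 i)//=.
rewrite [leLHS]addrC lerD2l.
rewrite /lower_end [leLHS]big_mkcond [leRHS]big_mkcond/=; apply: ler_sum => k _.
case: ifPn => ki; last by case: ifPn.
rewrite (ltn_trans ki ij)/=; case: eqP => [ke|//].
by move: ki; rewrite ke ltnn.
Qed.

(** Two nonempty open intervals meet iff each begins before the other ends. *)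
Definition overlap (I J : finType) (f : I -> R) (g : J -> R)
    (p : I * J) : bool :=
  [&& 0 < f p.1, 0 < g p.2, lower_end f p.1 < upper_end g p.2
    & lower_end g p.2 < upper_end f p.1].

Definition active_rank (I : finType) (f : I -> R) (i : I) : nat :=
  #|[pred k | (0 < f k) && (enum_rank k < enum_rank i)%N]|.

Lemma active_rank_lt (I : finType) (f : I -> R) (i : I) :
  0 < f i -> (active_rank f i < #|[pred k | (0 < f k)%R]|)%N.
Proof.
move=> fi; apply/proper_card/properP; split.
  by apply/fintype.subsetP => k; rewrite !inE => /andP[].
by exists i; rewrite !inE ?fi// ltnn andbF.
Qed.

Lemma active_rank_mono (I : finType) (f : I -> R) (i j : I) : 0 < f i ->
  (enum_rank i < enum_rank j)%N -> (active_rank f i < active_rank f j)%N.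
Proof.
move=> fi ij; apply/proper_card/properP; split.
  apply/fintype.subsetP => k; rewrite !inE => /andP[-> /=] /ltn_trans; exact.
by exists i; rewrite !inE ?fi// ltnn andbF.
Qed.

(** The two coordinates never order two overlapping pairs oppositely, so these
    pairs form a chain in the product of the two orders. A chain in a product of
    chains with [a] and [b] elements has at most [a + b - 1]
    elements, because the sum of the ranks is injective on it. *)
Lemma card_overlap (I J : finType) (f : I -> R) (g : J -> R) :
  (forall i, 0 <= f i) -> (forall j, 0 <= g j) ->
  (exists i, 0 < f i) -> (exists j, 0 < g j) ->
  (#|[pred p | overlap f g p]| + 1 <=
     #|[pred i | (0 < f i)%R]| + #|[pred j | (0 < g j)%R]|)%N.
Proof.
move=> f0 g0 [i0 fi0] [j0 gj0].
set a := #|[pred i | _]|; set b := #|[pred j | _]|.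
have a0 : (0 < a)%N by apply/card_gt0P; exists i0.
have b0 : (0 < b)%N by apply/card_gt0P; exists j0.
pose h (p : I * J) : 'I_((a + b - 1).-1.+1) :=
  inord (active_rank f p.1 + active_rank g p.2).
have hE p : overlap f g p ->
    h p = (active_rank f p.1 + active_rank g p.2)%N :> nat.
  move=> /and4P[fp gp _ _]; rewrite inordK//.
  have := active_rank_lt fp; have := active_rank_lt gp.
  rewrite -/a -/b; lia.
suff hinj : {in [pred p | overlap f g p] &, injective h}.
  have := @leq_card_in _ _ h _ hinj; rewrite card_ord.
  by set m := #|_|; move: m; lia.
(* If p.1 comes before q.1 and q.2 before p.2, then the break points satisfy
   upper p.1 <= lower q.1 < upper q.2 <= lower p.2 < upper p.1. *)
have mono p q : overlap f g p -> overlap f g q ->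
    (enum_rank p.1 < enum_rank q.1)%N -> (h p < h q)%N.
  move=> op oq pq; rewrite !hE//.
  case/and4P: (op) => fp gp p1 p2; case/and4P: (oq) => fq gq q1 q2.
  have r1 := active_rank_mono fp pq.
  case: (ltngtP (enum_rank p.2) (enum_rank q.2)) => pq2.
  - by have := active_rank_mono gp pq2; lia.
  - have := upper_end_le f0 pq; have := upper_end_le g0 pq2; lra.
  - have -> : p.2 = q.2 by apply: enum_rank_inj; exact: val_inj.
    by rewrite ltn_add2r.
move=> p q; rewrite !inE => op oq hpq.
case: (ltngtP (enum_rank p.1) (enum_rank q.1)) => pq.
- by have := mono _ _ op oq pq; rewrite hpq ltnn.
- by have := mono _ _ oq op pq; rewrite hpq ltnn.
have pq1 : p.1 = q.1 by apply: enum_rank_inj; exact: val_inj.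
have /eqP := congr1 val hpq; rewrite /= !hE// pq1 eqn_add2l => /eqP hpq2.
case/and4P: op => _ gp _ _; case/and4P: oq => _ gq _ _.
rewrite [p]surjective_pairing [q]surjective_pairing pq1; congr pair.
apply: enum_rank_inj; apply: val_inj => /=.
case: (ltngtP (enum_rank p.2) (enum_rank q.2)) => // pq2.
- by have := active_rank_mono gp pq2; rewrite hpq2 ltnn.
- by have := active_rank_mono gq pq2; rewrite hpq2 ltnn.
Qed.

Lemma lower_end_first (I : finType) (f : I -> R) :
  (forall i, 0 <= f i) -> (exists i, 0 < f i) ->
  exists2 i, 0 < f i & lower_end f i = 0.
Proof.
move=> f0 [i0 fi0].
case: (@arg_minnP _ i0 [pred i | 0 < f i] (fun i => enum_rank i) fi0).
move=> i fi imin; exists i => //; apply: big1 => k ki.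
apply/eqP; rewrite eq_le f0 andbT leNgt; apply/negP => /imin.
by rewrite leqNgt ki.
Qed.

(** The first nonempty intervals of both families start at 0. The two total
    lengths may differ, so bump functions can be used without normalisation. *)
Lemma exists_overlap (I J : finType) (f : I -> R) (g : J -> R) :
  (forall i, 0 <= f i) -> (forall j, 0 <= g j) ->
  (exists i, 0 < f i) -> (exists j, 0 < g j) -> exists p, overlap f g p.
Proof.
move=> f0 g0 /(lower_end_first f0)[i fi li] /(lower_end_first g0)[j gj lj].
by exists (i, j); rewrite /overlap/= /upper_end li lj !add0r fi gj.
Qed.

End Staircase.

(** * Distances of distinct scales between points of the line *)

Section Gaps.
Variable R : realType.

(** The distance is the sum of at most [N] gaps, so one of them is at least
    the average. *)
Lemma large_gap (s : nat -> R) (N a b : nat) : (a < b)%N -> (b <= N)%N ->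
  (forall i j, (i <= j)%N -> (j <= b)%N -> s i <= s j) ->
  exists i, [/\ (i < b)%N, s b - s a <= N%:R * (s i.+1 - s i)
    & s i.+1 - s i <= s b - s a].
Proof.
move=> ab bN mono.
have [i [ai ib gi]] : exists i, [/\ (a <= i)%N, (i < b)%N &
    s b - s a <= N%:R * (s i.+1 - s i)].
  apply: contrapT => /forallNP small.
  have lt i : (a <= i < b)%N -> N%:R * (s i.+1 - s i) < s b - s a.
    move=> /andP[ai ib]; rewrite ltNge; apply/negP => gi.
    by apply: (small i).
  have : N%:R * (s b - s a) < \sum_(a <= i < b) (s b - s a).
    rewrite -[in ltLHS](telescope_sumr _ (ltnW ab)) mulr_sumr.
    by apply: ltr_sum_nat => // i; exact: lt.
  rewrite sumr_const_nat -[(_ - _) *+ _]mulr_natl ltNge ler_wpM2r//.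
  - by rewrite subr_ge0 mono// ltnW.
  - by rewrite ler_nat; lia.
exists i; split=> //; apply: lerB; apply: mono => //; exact: ltnW.
Qed.

(** Each edge [e] joins two points of [s] at a distance in a window just above
    [(2 * N) ^ c e], so between its ends there is a gap of size between a
    fraction 1 / [N] of that scale and the scale plus 1. For distinct exponents
    these ranges of sizes are disjoint; hence the edges inject into the
    [(size s).-1] gaps of [s]. *)
Lemma card_scaled_edges (E : finType) (P : pred E) (u v : E -> R)
    (c : E -> nat) (s : seq R) (N : nat) :
  (0 < size s)%N -> (size s <= N)%N ->
  {in P &, injective c} ->
  (forall e, P e -> u e \in s) -> (forall e, P e -> v e \in s) ->
  (forall e, P e -> ((2 * N) ^ c e)%:R <= v e - u e < ((2 * N) ^ c e)%:R + 1) ->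
  (#|P| + 1 <= size s)%N.
Proof.
move=> s0 sN cinj us vs uv.
pose t := sort <=%R s.
have st : size t = size s by rewrite size_sort.
have tsorted : sorted <=%R t by apply: sort_sorted; exact: le_total.
have tmono i j : (i <= j)%N -> (j < size s)%N -> t`_i <= t`_j.
  move=> ij js; apply: (sorted_leq_nth le_trans le_refl) => //;
    rewrite inE st//; exact: leq_ltn_trans js.
have N0 : (0 < N)%N by lia.
have B0 k : (0 < (2 * N) ^ k)%N by rewrite expn_gt0; lia.
have gap e : P e -> exists i, [/\ (i < (size s).-1)%N,
    ((2 * N) ^ c e)%:R <= N%:R * (t`_i.+1 - t`_i)
    & t`_i.+1 - t`_i < ((2 * N) ^ c e)%:R + 1].
  move=> Pe; have /andP[uv1 uv2] := uv e Pe.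
  have ut : u e \in t by rewrite mem_sort us.
  have vt : v e \in t by rewrite mem_sort vs.
  set a := index (u e) t; set b := index (v e) t.
  have ta : t`_a = u e by rewrite nth_index.
  have tb : t`_b = v e by rewrite nth_index.
  have bs : (b < size s)%N by rewrite -st index_mem.
  have as_ : (a < size s)%N by rewrite -st index_mem.
  have ab : (a < b)%N.
    rewrite ltnNge; apply/negP => ba; have := tmono _ _ ba as_.
    rewrite ta tb => vu.
    have : (0 : R) < ((2 * N) ^ c e)%:R by rewrite ltr0n.
    lra.
  have := @large_gap (fun i => t`_i) N a b ab (leq_trans (ltnW bs) sN).
  case=> [i j ij jb|i [ib g1 g2]].
    by apply: tmono => //; exact: leq_ltn_trans bs.
  rewrite ta tb in g1 g2.
  exists i; split; [lia| lra | lra].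
pose h e : 'I_((size s).-1.-1.+1) :=
  if pselect (P e) is left Pe then
    inord (xget 0%N [set i | [/\ (i < (size s).-1)%N,
    ((2 * N) ^ c e)%:R <= N%:R * (t`_i.+1 - t`_i)
    & t`_i.+1 - t`_i < ((2 * N) ^ c e)%:R + 1]]) else ord0.
have hP e : P e -> [/\ (h e < (size s).-1)%N,
    ((2 * N) ^ c e)%:R <= N%:R * (t`_(h e).+1 - t`_(h e))
    & t`_(h e).+1 - t`_(h e) < ((2 * N) ^ c e)%:R + 1].
  move=> Pe; rewrite /h; case: pselect => // Pe'.
  case: xgetP => [i ->|/(_ _)]; last by case: (gap e Pe) => i /[swap] /[apply].
  by move=> [i1 i2 i3]; rewrite inordK//; lia.
have lec e e' : P e -> P e' -> h e = h e' -> (c e' <= c e)%N.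
  move=> /hP[_ _ e1] /hP[_ e2 _] hee; rewrite leqNgt; apply/negP => cc.
  rewrite -hee in e2; set d := _ - _ in e1 e2.
  have : ((2 * N) ^ (c e).+1 <= (2 * N) ^ c e')%N by rewrite leq_pexp2l//; lia.
  rewrite -(ler_nat R) expnS !natrM => dd.
  have x1 : (1 : R) <= ((2 * N) ^ c e)%:R by rewrite (ler_nat R 1).
  have nd : N%:R * d < N%:R * (2 * ((2 * N) ^ c e)%:R).
    by rewrite ltr_pM2l ?ltr0n//; lra.
  by have := le_lt_trans (le_trans dd e2) nd; rewrite mulrCA mulrA ltxx.
have hinj : {in P &, injective h}.
  move=> e e' Pe Pe' hee; apply: cinj => //; apply/eqP.
  by rewrite eqn_leq (lec _ _ Pe Pe' hee) (lec _ _ Pe' Pe (esym hee)).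
have := @leq_card_in _ _ h _ hinj; rewrite card_ord.
have [|s1] := posnP (size s).-1; last by lia.
move=> s1; suff -> : #|P| = 0%N by lia.
apply: eq_card0 => e; apply/negP => /hP[he _ _]; lia.
Qed.

End Gaps.

(** * Finite families of open sets *)

Definition mult (X : Type) (I : finType) (V : I -> set X) (x : X) : nat :=
  #|[pred i | `[< V i x >]]|.

Definition open_cover (X : topologicalType) (I : finType) (V : I -> set X) :=
  (forall i, open (V i)) /\ (forall x, exists i, V i x).

Section Topology.
Variables (R : realType) (X : metricType R).

(** The distance to the complement, or 1 when the complement is empty. *)
Lemma bump_function (U : set X) : open U ->
  exists f : X -> R, [/\ continuous f, forall x, 0 <= f x
    & forall x, (0 < f x) <-> U x].
Proof.
move=> oU; have [UT|/setTPn[a nUa]] := eqVneq U setT.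
  exists (fun=> 1); split=> [x|x|x]; [exact: cvg_cst|by []|].
  by rewrite UT ltr01.
pose d := edist_inf (~` U).
have dfin x : d x \is a fin_num.
  rewrite ge0_fin_numE; last exact: edist_inf_ge0.
  apply: le_lt_trans; first by apply: ereal_inf_lbound; exists a.
  rewrite -ge0_fin_numE; last exact: edist_ge0.
  apply/edist_finP; exists (mdist x a + 1) => /=.
    by have := mdist_ge0 x a; lra.
  by rewrite ballEmdist/=; lra.
have d0 x : 0 <= fine (d x) by apply: fine_ge0; exact: edist_inf_ge0.
exists (fine \o d); split=> // x.
  apply: fine_cvg; rewrite /= fineK//; exact: edist_inf_continuous.
split=> [dx|Ux] /=.
  by apply: contrapT => nUx; move: dx; rewrite /= /d edist_inf0// ltxx.
have [e /= e0 xeU] : exists2 e : R, 0 < e & ball x e `<=` U.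
  by have /nbhs_ballP[e /= e0 eU] := open_nbhs_nbhs (conj oU Ux); exists e.
rewrite -lte_fin fineK// (@lt_le_trans _ _ e%:E)//.
apply: le_ereal_inf_tmp => _ [b nUb <-]; rewrite leNgt; apply/negP.
by move=> /edist_lt_ball /= /xeU.
Qed.

(** The filter of finite lists ordered by inclusion turns [near_covering] into the
    extraction of a finite subcover. *)
Lemma compact_finite_subcover (O : X -> set X) : compact [set: X] ->
  (forall x, nbhs x (O x)) ->
  exists s : seq X, forall x, exists2 y, y \in s & O y x.
Proof.
move=> /compact_near_coveringP cX nO.
pose F : set_system (seq X) :=
  [set S | exists s0 : seq X, forall s : seq X, {subset s0 <= s} -> S s].
have FF : Filter F.
  split.
  - by exists [::].
  - move=> P Q [s0 P0] [s1 Q1]; exists (s0 ++ s1) => s ss; split.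
      by apply: P0 => z zs; apply: ss; rewrite mem_cat zs.
    by apply: Q1 => z zs; apply: ss; rewrite mem_cat zs orbT.
  - by move=> P Q PQ [s0 P0]; exists s0 => s /P0 /PQ.
have [|s0 s0P] := cX _ F (fun s x => exists2 y, y \in s & O y x) FF.
  move=> x _; exists (O x, [set s | x \in s]) => /=.
    by split; [exact: nO|exists [:: x] => s ss; apply: ss; rewrite inE].
  by move=> [z s] [/= Oz xs]; exists x.
by exists s0 => x; apply: (s0P s0).
Qed.

Lemma lower_end_continuous (I : finType) (f : I -> X -> R) (i : I) :
  (forall k, continuous (f k)) -> continuous (fun x => lower_end (f^~ x) i).
Proof.
move=> cf x; rewrite /lower_end.
apply: cvg_big => [|k _]; [exact: add_continuous|exact: cf].
Qed.

Lemma open_lt_fun (f g : X -> R) : continuous f -> continuous g ->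
  open [set x | f x < g x].
Proof.
move=> cf cg.
have -> : [set x | f x < g x] = (fun x => g x - f x) @^-1` [set y | 0 < y].
  by apply/seteqP; split=> x /=; rewrite subr_gt0.
apply: open_comp; last exact: open_gt.
by move=> x _; apply: cvgB; [exact: cg|exact: cf].
Qed.

(** The sets of the refinement are the loci where the interval of [i] meets the
    interval of [j]; they are open because the ends of the intervals depend
    continuously on the point. *)
Lemma common_refinement2 (I J : finType) (V : I -> set X) (W : J -> set X) :
  open_cover V -> open_cover W ->
  exists O : I * J -> set X, [/\ open_cover O,
    forall p, O p `<=` V p.1 `&` W p.2
    & forall x, (mult O x + 1 <= mult V x + mult W x)%N].
Proof.
move=> [oV cV] [oW cW].
have [f fP] := choice (fun i => bump_function (oV i)).
have [g gP] := choice (fun j => bump_function (oW j)).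
have f0 x i : 0 <= f i x by case: (fP i).
have g0 x j : 0 <= g j x by case: (gP j).
have fc i : continuous (f i) by case: (fP i).
have gc j : continuous (g j) by case: (gP j).
have fV i x : 0 < f i x <-> V i x by case: (fP i).
have gW j x : 0 < g j x <-> W j x by case: (gP j).
have f1 x : exists i, 0 < f i x by have [i /fV] := cV x; exists i.
have g1 x : exists j, 0 < g j x by have [j /gW] := cW x; exists j.
have multV x : mult V x = #|[pred i | 0 < f i x]|.
  by apply: eq_card => i; rewrite !inE; apply/asboolP/idP => /fV.
have multW x : mult W x = #|[pred j | 0 < g j x]|.
  by apply: eq_card => j; rewrite !inE; apply/asboolP/idP => /gW.
exists (fun p => [set x | overlap (f^~ x) (g^~ x) p]); split.
- split=> [p|x]; last exact: exists_overlap.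
  have -> : [set x | overlap (f^~ x) (g^~ x) p] =
      ([set x | 0 < f p.1 x] `&` [set x | 0 < g p.2 x]) `&`
      ([set x | lower_end (f^~ x) p.1 < upper_end (g^~ x) p.2] `&`
       [set x | lower_end (g^~ x) p.2 < upper_end (f^~ x) p.1]).
    apply/seteqP; split=> x /=; first by move=> /and4P[].
    by move=> [[h1 h2] [h3 h4]]; apply/and4P; split.
  have cst0 : continuous (fun _ : X => 0 : R) by move=> ?; exact: cvg_cst.
  have lf : continuous (fun x => lower_end (f^~ x) p.1).
    exact: lower_end_continuous.
  have lg : continuous (fun x => lower_end (g^~ x) p.2).
    exact: lower_end_continuous.
  apply: openI; apply: openI; apply: open_lt_fun => //.
    by move=> x; apply: cvgD; [exact: lg|exact: gc].
  by move=> x; apply: cvgD; [exact: lf|exact: fc].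
- by move=> p x /= /and4P[/fV ? /gW].
- move=> x; rewrite multV multW.
  have -> : mult (fun p => [set x | overlap (f^~ x) (g^~ x) p]) x =
      #|[pred p | overlap (f^~ x) (g^~ x) p]|.
    by apply: eq_card => p; rewrite !inE asboolb.
  exact: card_overlap.
Qed.

(** In terms of orders, [mult - 1] is subadditive under this refinement; the form
    below avoids the truncated subtraction. *)
Lemma common_refinement (K : eqType) (I : finType) (V : K -> I -> set X)
    (s : seq K) : (forall k, open_cover (V k)) ->
  exists (J : finType) (O : J -> set X), [/\ open_cover O,
    forall k, k \in s -> forall j, exists i, O j `<=` V k i
    & forall x, (mult O x + size s <= \sum_(k <- s) mult (V k) x + 1)%N].
Proof.
move=> cV; elim: s => [|k s [J [Q [cQ QV mQ]]]].
  exists unit, (fun=> setT); split=> //.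
    by split=> [i|x]; [exact: openT|exists tt].
  move=> x; rewrite big_nil addn0.
  by rewrite (leq_trans (max_card _))// card_unit.
have [P [cP PV mP]] := common_refinement2 (cV k) cQ.
exists (I * J)%type, P; split=> //.
  move=> k'; rewrite inE => /predU1P[->|k's] p.
    by exists p.1 => x /PV[].
  by have [i Qi] := QV _ k's p.2; exists i => x /PV[_ /Qi].
move=> x; rewrite big_cons /=; have := mP x; have := mQ x.
by move: (mult P x) (mult Q x) (mult (V k) x) (\sum_(_ <- s) _)%N; lia.
Qed.

End Topology.

(** * Equivariant covers *)

(** dim X <= n, in terms of indexed families. *)
Definition dim_le (X : topologicalType) (n : nat) :=
  forall (I : finType) (U : I -> set X), open_cover U ->
  exists (J : finType) (V : J -> set X), [/\ open_cover V,
    forall j, exists i, V j `<=` U i & forall x, (mult V x <= n.+1)%N].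

Lemma open_forall (X : topologicalType) (I : finType) (F : I -> set X) :
  (forall i, open (F i)) -> open [set x | forall i, F i x].
Proof.
move=> oF; rewrite openE => x Fx; apply: filter_forall => i.
by apply: open_nbhs_nbhs; split; [exact: oF|exact: Fx].
Qed.

Lemma leq_mult (X Y : Type) (I J : finType) (V : I -> set X) (W : J -> set Y)
    (r : I -> J) (x : X) (y : Y) :
  (forall j, W j y -> exists2 i, V i x & r i = j) -> (mult W y <= mult V x)%N.
Proof.
move=> WV; apply: (leq_trans _ (leq_image_card r _)).
apply: subset_leq_card; apply/fintype.subsetP => j Wj.
have /WV[i Vi <-] : W j y by apply/asboolP; exact: Wj.
by apply: fintype.image_f; apply/asboolP.
Qed.

Section Action.
Variables (Gamma : finGroupType) (X : topologicalType).
Variable T : dynamical_system Gamma X.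

Lemma act_continuous g : continuous (T g).
Proof. by case: (dyn_homeo T g). Qed.

Lemma actM g h x : T (g * h)%g x = T g (T h x).
Proof. by rewrite dyn_actM. Qed.

Lemma act1 x : T 1%g x = x.
Proof.
have [_ [f [_ fK _]]] := dyn_homeo T 1%g.
by apply: (can_inj fK); rewrite -actM mulg1.
Qed.

Lemma actK g : cancel (T g) (T g^-1%g).
Proof. by move=> x; rewrite -actM mulVg act1. Qed.

Lemma actVK g : cancel (T g^-1%g) (T g).
Proof. by move=> x; rewrite -actM mulgV act1. Qed.

Lemma open_act_preimage g (U : set X) : open U -> open (T g @^-1` U).
Proof. by move=> oU; apply: open_comp => // x _; exact: act_continuous. Qed.

Definition translates (K : finType) (W : K -> set X) (p : Gamma * K) : set X :=
  T p.1 @^-1` W p.2.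

Definition wandering (N : set X) :=
  forall g x, N x -> N (T g x) -> g = 1%g.

Lemma open_cover_translates (K : finType) (W : K -> set X) (g : Gamma) :
  open_cover W -> open_cover (fun k => T g @^-1` W k).
Proof.
move=> [oW cW]; split=> [k|x]; first exact: open_act_preimage.
exact: cW.
Qed.

(** One step of the finite sum theorem. Refine all the translates of [W] by a
    cover [V] of order [n], through a map [r] of indices. Off the orbit of [B]
    nothing changes; on the orbit of [B], the set [W k] is replaced by the parts
    in [N] of those [V j] refining a translate of [W k], moved by the group
    element that takes this translate to [W k]. Since [N] is disjoint from its
    translates, a point of [B] lies in a translate of the new set only if it lies
    in the corresponding [V j] itself, and at most [n.+1] of these exist. *)
Lemma shrink_translates (n : nat) (K : finType) (W : K -> set X)
    (B N : set X) : dim_le X n -> (forall k, open (W k)) ->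
  open_cover (translates W) -> closed B -> open N -> B `<=` N -> wandering N ->
  exists W' : K -> set X, [/\ forall k, open (W' k), forall k, W' k `<=` W k,
    open_cover (translates W')
    & forall x, B x -> (mult (translates W') x <= n.+1)%N].
Proof.
move=> dimX oW cW cB oN BN Nfree.
have [J [V [[oV cV] VW mV]]] := dimX _ _ cW.
have [r rP] := choice VW.
pose moved k : set X := \bigcup_(j in [set j | (r j).2 = k])
  (T (r j).1^-1%g @^-1` (N `&` V j)).
pose W' k : set X :=
  (W k `&` [set x | forall h, (T h @^-1` (~` B)) x]) `|` moved k.
have oW' k : open (W' k).
  apply: openU.
    apply: openI => //; apply: open_forall => h; apply: open_act_preimage.
    exact: closed_openC.
  by apply: bigcup_open => j _; apply: open_act_preimage; exact: openI.
have W'W k : W' k `<=` W k.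
  move=> x [[]//|[j /= jk [_ Vx]]].
  by have := rP j _ Vx; rewrite /translates/= jk actVK.
exists W'; split=> //.
  split=> [p|x]; first exact: open_act_preimage.
  (* If the orbit of x meets B at T h x, then T h x is in N and some V j, and the
     moved copy of V j contains the point (r j).1 * h of the orbit. *)
  have [[h Bh]|/forallNP nB] := pselect (exists h, B (T h x)).
    have [j Vj] := cV (T h x).
    exists ((r j).1 * h, (r j).2)%g; right; exists j => //=.
    by rewrite -actM mulKg; split => //; exact: BN.
  have [[g k] Wx] := cW.2 x; exists (g, k); left; split => //= h.
  by rewrite /preimage/= -actM; exact: nB.
move=> x Bx; apply: leq_trans (mV x); apply: (@leq_mult _ _ _ _ V _ r).
move=> [g k] [[_ /(_ g^-1%g)]|[j /= jk]]; first by rewrite /preimage/= actK.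
rewrite /preimage/= -actM => -[Ngx Vgx].
have /eqP := Nfree _ _ (BN _ Bx) Ngx.
rewrite -eq_mulVg1 => /eqP gE; exists j; last first.
  by rewrite -jk -gE -surjective_pairing.
by move: Vgx; rewrite gE mulVg act1.
Qed.

(** Shrinking can only lower multiplicities, so the bounds obtained on the sets
    already treated persist. *)
Lemma shrink_translates_seq (n : nat) (K : finType) (W : K -> set X)
    (A : eqType) (B N : A -> set X) (s : seq A) :
  dim_le X n -> (forall k, open (W k)) -> open_cover (translates W) ->
  (forall a, closed (B a)) -> (forall a, open (N a)) ->
  (forall a, B a `<=` N a) -> (forall a, wandering (N a)) ->
  exists W' : K -> set X, [/\ forall k, open (W' k), forall k, W' k `<=` W k,
    open_cover (translates W')
    & forall a x, a \in s -> B a x -> (mult (translates W') x <= n.+1)%N].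
Proof.
move=> dimX oW cW cB oN BN Nfree; elim: s => [|a s [W1 [oW1 W1W cW1 mW1]]].
  by exists W; split => // k.
have [W2 [oW2 W21 cW2 mW2]] :=
  shrink_translates dimX oW1 cW1 (cB a) (oN a) (BN a) (Nfree a).
exists W2; split => // [k|b x]; first exact: subset_trans (W21 k) (W1W k).
rewrite inE => /predU1P[->|bs] Bx; first exact: mW2.
apply: leq_trans (mW1 b x bs Bx); apply: (@leq_mult _ _ _ _ _ _ id) => p W2p.
by exists p => //; exact: W21.
Qed.

End Action.

Section EquivariantCover.
Variables (R : realType) (Gamma : finGroupType) (X : metricType R).
Variable T : dynamical_system Gamma X.
Hypothesis Tfree : free_system T.

Lemma wandering_nbhs (I : finType) (U : I -> set X) (x : X) : open_cover U ->
  exists N : set X, [/\ open N, N x, wandering T N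
    & forall g, exists i, T g @^-1` N `<=` U i].
Proof.
move=> [oU cU].
have H g : exists P : set X, [/\ open P, P x,
    forall y, P y -> P (T g y) -> g = 1%g
    & exists i, T g @^-1` P `<=` U i].
  have [i Ui] := cU (T g^-1%g x).
  pose Q := T g^-1%g @^-1` U i.
  have oQ : open Q by exact: open_act_preimage.
  have QU : T g @^-1` Q `<=` U i by move=> y; rewrite /Q /preimage/= actK.
  have [g1|g1] := eqVneq g 1%g.
    by exists Q; split => //; exists i.
  have /eqP xgx : x <> T g x.
    rewrite -[X in X <> _](act1 T); apply: Tfree; apply/eqP.
    by rewrite eq_sym.
  have := metric_hausdorff (T := X); rewrite open_hausdorff.
  move=> /(_ _ _ xgx)[[A B] /= [xA gxB] [oA oB AB0]].
  exists (A `&` (T g @^-1` B) `&` Q); split.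
  - apply: openI => //; apply: openI => //; exact: open_act_preimage.
  - by split => //; split; move: xA gxB; rewrite !inE.
  - move=> y [[_ By] _] [[Agy _] _].
    by have : (A `&` B) (T g y) by []; rewrite (eqP AB0).
  - by exists i => y [_ /QU].
have [P PP] := choice H.
exists [set y | forall g, P g y]; split => //.
- by apply: open_forall => g; case: (PP g).
- by move=> g /=; case: (PP g).
- by move=> g y Py Pgy; have [_ _ Pg _] := PP g; exact: (Pg y (Py g) (Pgy g)).
- by move=> g; case: (PP g) => _ _ _ [i Pi]; exists i => y /(_ g) /Pi.
Qed.

(** Start from finitely many wandering neighborhoods [N x] that are small together
    with their translates; the closed sets are superlevel sets of bump functions
    of the [N x], and cover [X] by compactness. *)
Lemma equivariant_cover (n : nat) (I : finType) (U : I -> set X) :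
  compact [set: X] -> dim_le X n -> open_cover U ->
  exists (K : finType) (W : K -> set X), [/\ forall k, open (W k),
    open_cover (translates T W), forall k, wandering T (W k),
    forall p, exists i, translates T W p `<=` U i
    & forall x, (mult (translates T W) x <= n.+1)%N].
Proof.
move=> cX dimX cU.
have [N NP] := choice (fun x => wandering_nbhs x cU).
have oN x : open (N x) by case: (NP x).
have Nx x : N x x by case: (NP x).
have Nw x : wandering T (N x) by case: (NP x).
have [f fP] := choice (fun x => bump_function (oN x)).
have fc x : continuous (f x) by case: (fP x).
have fN x y : (0 < f x y) <-> N x y by case: (fP x).
have f0 x : 0 < f x x by apply/fN.
pose B x := f x @^-1` [set t | f x x / 2 <= t].
have cB x : closed (B x).
  by apply: preimage_closed => [y _|]; [exact: fc|exact: closed_ge].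
have BN x : B x `<=` N x.
  by move=> y; rewrite /B/= => By; apply/fN; have := f0 x; lra.
have nB x : nbhs x (B x).
  have : nbhs x (f x @^-1` [set t | f x x / 2 < t]).
    apply: open_nbhs_nbhs; split; last by have := f0 x; rewrite /=; lra.
    by apply: open_comp => [y _|]; [exact: fc|exact: open_gt].
  by apply: filterS => y /= /ltW.
have [s sP] := compact_finite_subcover cX nB.
pose W0 (k : seq_sub s) : set X := N (ssval k).
have cW0 : open_cover (translates T W0).
  split=> [p|x]; first by apply: open_act_preimage; exact: oN.
  have [y ys Byx] := sP x; exists (1%g, SeqSub ys).
  by rewrite /translates/W0/=/preimage/= act1; exact: BN.
have oW0 k : open (W0 k) by exact: oN.
have [W [oW WW0 cW mW]] :=
  @shrink_translates_seq _ _ T n _ W0 _ B N s dimX oW0 cW0 cB oN BN Nw.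
exists (seq_sub s), W; split => //.
- by move=> k g x /WW0 Nx1 /WW0; exact: (Nw (ssval k) g x Nx1).
- move=> [g k]; case: (NP (ssval k)) => _ _ _ /(_ g)[i Ni].
  by exists i => x /WW0 /Ni.
- by move=> x; have [y ys Byx] := sP x; exact: mW ys Byx.
Qed.

End EquivariantCover.

(** * General position *)

Section GenericCover.
Variables (R : realType) (Gamma : finGroupType) (X : metricType R).
Variable T : dynamical_system Gamma X.

(** The sets [V p] are almost-maximality loci for the functions
    [expR (l p) * F p], a closed cover thickened by a factor [expR 1]. At [T g x],
    the function [F p] takes the value of [F] with index [(p.1 * g, p.2)] at [x],
    so all the points of an orbit see the same numbers [F q x], with permuted
    constants. The constants being sparse powers, the number of almost ties over
    the whole orbit is bounded as if they were linear equations in general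
    position. *)
Lemma generic_cover (n : nat) (K : finType) (W : K -> set X) :
  (forall k, open (W k)) -> open_cover (translates T W) ->
  (forall k, wandering T (W k)) ->
  (forall x, (mult (translates T W) x <= n.+1)%N) ->
  exists V : Gamma * K -> set X, [/\ open_cover V,
    forall p, V p `<=` translates T W p
    & forall x, (\sum_(g : Gamma) mult V (T g x) <= n + #|Gamma|)%N].
Proof.
move=> oW [_ cW] Wfree mW.
have [f fP] := choice (fun k => bump_function (oW k)).
have fc k : continuous (f k) by case: (fP k).
have f0 k x : 0 <= f k x by case: (fP k).
have fW k x : 0 < f k x <-> W k x by case: (fP k).
pose N := (#|Gamma| + n.+1)%N.
pose l (p : Gamma * K) : R := ((2 * N) ^ enum_rank p)%:R.
pose F (p : Gamma * K) (x : X) : R := f p.2 (T p.1 x).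
have F0 p x : 0 <= F p x by exact: f0.
have FW p x : 0 < F p x <-> translates T W p x by exact: fW.
have Fc p : continuous (F p).
  move=> x; apply: (@continuous_comp _ _ _ (T p.1) (f p.2)); last exact: fc.
  exact: act_continuous.
have FT p g x : F p (T g x) = F ((p.1 * g)%g, p.2) x by rewrite /F/= actM.
pose V p : set X :=
  [set x | forall q, expR (l q) * F q x < expR (l p + 1) * F p x].
have cmul (c : R) p : continuous (fun x => c * F p x).
  by move=> x; apply: cvgM; [exact: cvg_cst|exact: Fc].
have VF p x : V p x -> 0 < F p x.
  move=> /(_ p) lt_p; have : 0 < expR (l p + 1) * F p x.
    by apply: le_lt_trans lt_p; rewrite mulr_ge0// expR_ge0.
  by rewrite pmulr_rgt0// expR_gt0.
(* The index realising the maximum shows that the sets V p cover. *)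
have maxF x : exists p, 0 < F p x /\
    forall q, expR (l q) * F q x <= expR (l p) * F p x.
  have [p0 /FW Fp0] := cW x.
  case: (@Order.TotalTheory.arg_maxP _ _ _ p0 xpredT
    (fun q => expR (l q) * F q x) isT) => p _ pmax.
  exists p; split=> [|q]; last exact: pmax.
  rewrite -(pmulr_rgt0 _ (expR_gt0 (l p))).
  by apply: lt_le_trans (pmax p0 isT); rewrite mulr_gt0// expR_gt0.
exists V; split.
- split=> [p|x].
    by apply: open_forall => q; apply: open_lt_fun; exact: cmul.
  have [p [Fp pmax]] := maxF x; exists p => q.
  apply: le_lt_trans (pmax q) _; rewrite ltr_pM2r// ltr_expR; lra.
- by move=> p x /VF /FW.
move=> x.
have [top topP] := choice (fun g => maxF (T g x)).
(* The edge (g, p), present when T g x lies in V p, joins the point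
   ln (F ((p.1 * g), p.2) x) to the point height g of the real line. *)
pose height g : R := ln (expR (l (top g)) * F (top g) (T g x)).
pose low (e : Gamma * (Gamma * K)) : R := ln (F e.2 (T e.1 x)).
pose s := [seq height g | g : Gamma] ++
  [seq ln (F p x) | p in [pred p | `[< translates T W p x >]]].
have size_s : size s = (#|Gamma| + mult (translates T W) x)%N.
  by rewrite size_cat !size_image.
pose P : pred (Gamma * (Gamma * K)) := fun e => `[< V e.2 (T e.1 x) >].
have sumE : (\sum_(g : Gamma) mult V (T g x))%N = #|P|.
  rewrite -sum1_card (eq_bigl (fun e => P (e.1, e.2))); last by case.
  rewrite -(pair_big_dep xpredT (fun g p => P (g, p)) (fun _ _ => 1%N))/=.
  by apply: eq_bigr => g _; rewrite sum1_card.
have s0 : (0 < size s)%N.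
  rewrite size_s addn_gt0; apply/orP; left.
  by apply/card_gt0P; exists 1%g.
have sN : (size s <= N)%N by rewrite size_s leq_add2l mW.
suff : (#|P| + 1 <= size s)%N.
  by rewrite sumE; move: sN; rewrite /N; lia.
apply: (@card_scaled_edges R _ P low (fun e => height e.1)
  (fun e => enum_rank e.2) s N) => //.
- (* The exponent determines the index p, and at most one translate of W k
     contains x: together they determine g. *)
  move=> [g [h k]] [g' p'] /asboolP/= Ve /asboolP/= Ve' /val_inj/enum_rank_inj.
  move=> /= pE; rewrite -pE in Ve' *; congr (_, _).
  have /FW := VF _ _ Ve; have /FW := VF _ _ Ve'.
  rewrite /translates/preimage/= -!actM => W1 W2.
  have := Wfree k ((h * g') * (h * g)^-1)%g _ W2.
  rewrite -actM mulgKV => /(_ W1)/eqP; rewrite -eq_mulgV1 => /eqP.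
  by move/mulgI.
- move=> [g p] /asboolP/= /VF; rewrite /low/= FT => Fp.
  rewrite mem_cat; apply/orP; right.
  by apply: fintype.image_f; apply/asboolP/FW.
- move=> e _; rewrite mem_cat; apply/orP; left; apply: fintype.image_f.
  by rewrite inE.
move=> [g p] /asboolP/= Ve; have Fp := VF _ _ Ve; rewrite -/(l p).
have [Ft topmax] := topP g.
have F1 : 0 < expR (l (top g)) * F (top g) (T g x).
  by rewrite mulr_gt0// expR_gt0.
have lnE a : ln (expR a * F p (T g x)) = a + low (g, p).
  by rewrite lnM ?expRK// posrE// expR_gt0.
have F2 a : 0 < expR a * F p (T g x) by rewrite mulr_gt0// expR_gt0.
have := topmax p; rewrite -ler_ln ?posrE// lnE -/(height g) => h1.
have := Ve (top g); rewrite -ltr_ln ?posrE// lnE -/(height g) => h2.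
apply/andP; split; lra.
Qed.

Lemma orbit_sum_cover (n : nat) (I : finType) (U : I -> set X) :
  free_system T -> compact [set: X] -> dim_le X n -> open_cover U ->
  exists (J : finType) (V : J -> set X), [/\ open_cover V,
    forall j, exists i, V j `<=` U i
    & forall x, (\sum_(g : Gamma) mult V (T g x) <= n + #|Gamma|)%N].
Proof.
move=> Tfree cX dimX cU.
have [K [W [oW cW Ww WU mW]]] := equivariant_cover Tfree cX dimX cU.
have [V [cV VW mV]] := generic_cover oW cW Ww mW.
exists (Gamma * K)%type, V; split => // p.
by have [i Wi] := WU p; exists i; exact: subset_trans Wi.
Qed.

End GenericCover.

Lemma cover_family (X : topologicalType) (UU : set (set X)) :
  finite_open_cover UU ->
  exists (I : finType) (U : I -> set X),
    [/\ open_cover U, range U = UU & injective U].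
Proof.
case=> /finite_seqP[s UUs] oU cU.
have sUU V : V \in s <-> UU V by rewrite UUs.
exists (seq_sub s), (fun i => ssval i); split; last exact: val_inj.
- split=> [i|x]; first by apply/oU/sUU; exact: ssvalP.
  have [V /sUU Vs Vx] : (\bigcup_(U in UU) U) x by rewrite cU.
  by exists (SeqSub Vs).
- apply/seteqP; split=> [_ [i _ <-]|V /sUU Vs]; first by apply/sUU; exact: ssvalP.
  by exists (SeqSub Vs).
Qed.

Lemma finite_open_cover_range (X : topologicalType) (I : finType)
    (U : I -> set X) : open_cover U -> finite_open_cover (range U).
Proof.
move=> [oU cU]; split.
- exact: finite_image.
- by move=> _ [i _ <-].
- apply/seteqP; split=> // x _; have [i Ui] := cU x.
  by exists (U i) => //; exists i.
Qed.

(** * Orders of covers and invariant probabilities *)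

Section CoverOrd.
Variables (R : realType) (X : topologicalType).

Lemma multE (I : finType) (U : I -> set X) (x : X) :
  (mult U x)%:R = \sum_i \1_(U i) x :> R.
Proof.
rewrite /mult -sum1_card natr_sum big_mkcond/=; apply: eq_bigr => i _.
rewrite indicE; case: ifPn => [/asboolP Ux|/asboolP Ux].
  by rewrite mem_set.
by rewrite memNset.
Qed.

Lemma cover_ord_inj (I : finType) (U : I -> set X) (x : X) : injective U ->
  cover_ord R (range U) x = (mult U x)%:R - 1.
Proof.
move=> Uinj; rewrite /cover_ord addrC; congr (_ - 1); rewrite multE.
rewrite fsbig_image; last by move=> i j _ _; exact: Uinj.
have -> : [set: I] = [set` index_enum I].
  by apply/seteqP; split=> i //= _; exact: mem_index_enum.
by rewrite -fsbig_seq// index_enum_uniq.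
Qed.

(** Only an inequality: distinct indices may carry the same set. *)
Lemma cover_ord_le (I : finType) (U : I -> set X) (x : X) : open_cover U ->
  cover_ord R (range U) x <= (mult U x)%:R - 1.
Proof.
move=> /finite_open_cover_range /cover_family [J [V [_ VU Vinj]]].
rewrite -VU cover_ord_inj// lerD2r ler_nat.
have [r rP] : {r : I -> J & forall i, V (r i) = U i}.
  apply: (@choice _ _ (fun i j => V j = U i)) => i.
  have : range V (U i) by rewrite VU; exists i.
  by move=> [j _ <-]; exists j.
apply: (@leq_mult _ _ _ _ _ _ r) => j Vj.
have : range U (V j) by rewrite -VU; exists j.
by move=> [i _ Ui]; exists i; [rewrite Ui|apply: Vinj; rewrite rP].
Qed.

Lemma mult_gt0 (I : finType) (U : I -> set X) (x : X) : open_cover U ->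
  (0 < mult U x)%N.
Proof.
by move=> [_ /(_ x)[i Ui]]; apply/card_gt0P; exists i; exact/asboolP.
Qed.

Lemma cover_ord_ge0 (UU : set (set X)) (x : X) : finite_open_cover UU ->
  0 <= cover_ord R UU x.
Proof.
move=> /cover_family [I [U [cU <- Uinj]]].
by rewrite cover_ord_inj// subr_ge0 (ler_nat _ 1) mult_gt0.
Qed.

End CoverOrd.

Section InvariantProbs.
Variables (R : realType) (Gamma : finGroupType) (X : topologicalType).
Variable T : dynamical_system Gamma X.

Lemma measurable_act (x0 : X) (g : Gamma) :
  measurable_fun [set: borel_type x0] (T g : borel_type x0 -> borel_type x0).
Proof.
apply: measurability; first by [].
move=> _ [U oU <-]; rewrite setTI; apply: sub_sigma_algebra.
exact: (@open_act_preimage _ _ T g U oU).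
Qed.

Lemma measurable_cover_ord (x0 : X) (UU : set (set X)) :
  finite_open_cover UU ->
  measurable_fun [set: borel_type x0]
    (EFin \o (cover_ord R UU : borel_type x0 -> R)).
Proof.
move=> /cover_family [I [U [[oU _] <- Uinj]]].
apply/measurable_EFinP.
rewrite [X in measurable_fun _ X](_ : _ =
  (fun x => \sum_(i <- index_enum I) \1_(U i) x - 1)); last first.
  by apply/funext => x; rewrite cover_ord_inj// multE.
apply: measurable_funB; last exact: measurable_cst.
apply: (@measurable_sum _ (borel_type x0) R setT _ _ (fun i => \1_(U i))) => i.
by apply: measurable_indic; apply: sub_sigma_algebra; exact: oU.
Qed.

Local Open Scope ereal_scope.

Lemma card_group_gt0 : (0 < #|Gamma|%:R :> R)%R.
Proof. by rewrite ltr0n; apply/card_gt0P; exists 1%g. Qed.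

Lemma integral_act (mu : borel_prob R X) (g : Gamma)
    (f : borel_type (bp_base mu) -> \bar R) :
  invariant_probs R T mu -> measurable_fun setT f -> (forall x, 0 <= f x) ->
  bp_integral mu (f \o T g) = bp_integral mu f.
Proof.
move=> invmu mf f0; rewrite /bp_integral.
have := @ge0_integral_pushforward _ _ _ _ R _ (@measurable_act (bp_base mu) g)
  (bp_meas mu) setT f measurableT mf (fun x _ => f0 x).
rewrite preimage_setT => <-.
apply: eq_measure_integral => [|mphi A mA _]; first exact: measurable_act.
exact: invmu.
Qed.

(** By invariance, [#|Gamma|] times the integral is the integral of the orbit
    sum. *)
Lemma bp_integral_le_orbit_sum (mu : borel_prob R X) (UU : set (set X)) (c : R) :
  invariant_probs R T mu -> finite_open_cover UU ->
  (forall x, (\sum_(g : Gamma) cover_ord R UU (T g x) <= c)%R) ->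
  bp_integral mu (fun x => (cover_ord R UU x)%:E) <= (#|Gamma|%:R^-1 * c)%:E.
Proof.
move=> invmu fU cle.
set f : borel_type (bp_base mu) -> \bar R := fun x => (cover_ord R UU x)%:E.
have f0 x : 0 <= f x by rewrite lee_fin cover_ord_ge0.
have mf : measurable_fun setT f by exact: measurable_cover_ord.
have G0 := card_group_gt0.
have mfg g : measurable_fun setT
    (f \o (T g : borel_type (bp_base mu) -> borel_type (bp_base mu))).
  by apply: measurableT_comp => //; exact: measurable_act.
have sum_int : \sum_(g : Gamma) bp_integral mu (f \o T g) <= c%:E.
  rewrite /bp_integral -ge0_integral_sum//; last by move=> g x _; exact: f0.
  rewrite -[leRHS]mule1 -(@probability_setT _ _ _ (bp_meas mu)).
  rewrite -integral_cst//; apply: ge0_le_integral => //.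
  - by move=> x _; apply: sume_ge0 => g _; exact: f0.
  - exact: emeasurable_sum.
  - by move=> x _; rewrite sumEFin lee_fin.
rewrite EFinM lee_pdivlMl//; apply: le_trans sum_int.
under eq_bigr do rewrite integral_act//.
by rewrite sumr_const mule_natl.
Qed.

Section OrbitMeasure.
Variable x : X.

Let orbit_point (n : nat) : borel_type x := T (nth 1%g (enum Gamma) n) x.

(** The image of the uniform probability on [Gamma] under the orbit map of [x]. *)
Definition orbit_measure : set (borel_type x) -> \bar R :=
  mscale ((#|Gamma|%:R^-1)%:nng : {nonneg R})%R
    (msum (fun n => @dirac _ _ (orbit_point n) R) #|Gamma|).

HB.instance Definition _ := Measure.on orbit_measure.

Lemma sum_orbit (V : nmodType) (F : X -> V) :
  (\sum_(n < #|Gamma|) F (orbit_point n) = \sum_(g : Gamma) F (T g x))%R.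
Proof.
rewrite [RHS](reindex (@enum_val _ (mem Gamma)))/=; last first.
  by exists enum_rank => [i|g] _; rewrite ?enum_valK ?enum_rankK.
by apply: eq_bigr => i _; rewrite /orbit_point (enum_val_nth 1%g).
Qed.

Lemma orbit_measureE (A : set (borel_type x)) :
  orbit_measure A =
  (#|Gamma|%:R^-1)%:E * \sum_(g : Gamma) \d_(T g x : borel_type x) A.
Proof.
rewrite /orbit_measure /mscale /msum/=; congr (_ * _).
exact: (sum_orbit (fun y => \d_(y : borel_type x) A)).
Qed.

Lemma orbit_measure_setT : orbit_measure setT = 1.
Proof.
rewrite orbit_measureE (eq_bigr (fun=> 1%R%:E)) => [|g _]; last exact: diracT.
by rewrite sumEFin sumr_const -EFinM mulVf// lt0r_neq0// card_group_gt0.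
Qed.

HB.instance Definition _ :=
  Measure_isProbability.Build _ _ _ orbit_measure orbit_measure_setT.

Definition orbit_prob : borel_prob R X :=
  @BorelProb R X x (orbit_measure : probability (borel_type x) R).

Lemma orbit_prob_invariant : invariant_probs R T orbit_prob.
Proof.
move=> g A mA /=; rewrite !orbit_measureE; congr (_ * _).
rewrite [RHS](reindex_inj (mulgI g))/=; apply: eq_bigr => h _.
by rewrite !diracE actM.
Qed.

Lemma bp_integral_orbit_prob (UU : set (set X)) : finite_open_cover UU ->
  bp_integral orbit_prob (fun y => (cover_ord R UU y)%:E) =
  (#|Gamma|%:R^-1 * \sum_(g : Gamma) cover_ord R UU (T g x))%:E.
Proof.
move=> fU; rewrite /bp_integral /=.
have mf := measurable_cover_ord (x0 := x) fU.
rewrite ge0_integral_mscale//; last by move=> y _; rewrite lee_fin cover_ord_ge0.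
rewrite ge0_integral_measure_sum//; last first.
  by move=> y _; rewrite lee_fin cover_ord_ge0.
rewrite EFinM -sumEFin -(sum_orbit (fun y => (cover_ord R UU y)%:E)) /=.
congr (_ * _); apply: eq_bigr => n _.
by rewrite integral_dirac// diracT mul1e.
Qed.

End OrbitMeasure.

End InvariantProbs.

(** * Comparison of the two dimensions *)

Section SupInf.
Variables (R : realType) (X : topologicalType).
Local Open Scope ereal_scope.

Lemma le_sup_inf_covers (F G : set (set X) -> \bar R) :
  (forall UU VV : set (set X), finite_open_cover UU ->
    finite_open_cover VV -> refines VV UU ->
    exists WW, [/\ finite_open_cover WW, refines WW UU & F WW <= G VV]) ->
  sup_inf_covers F <= sup_inf_covers G.
Proof.
move=> FG; apply: ge_ereal_sup => _ [UU cU <-].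
apply: le_ereal_sup_tmp; eexists; first by exists UU.
apply: le_ereal_inf_tmp => _ [VV [cV VU] <-].
have [WW [cW WU FGW]] := FG _ _ cU cV VU.
by apply: le_trans FGW; apply: ereal_inf_lbound; exists WW.
Qed.

Lemma sup_inf_covers_pZl (F : set (set X) -> \bar R) (a : R) : (0 < a)%R ->
  sup_inf_covers (fun VV => a%:E * F VV) = a%:E * sup_inf_covers F.
Proof.
move=> a0; rewrite /sup_inf_covers -ereal_sup_pZl//; congr ereal_sup.
rewrite image_comp; apply: eq_imagel => UU _ /=.
by rewrite -ereal_inf_pZl// image_comp.
Qed.

Lemma eq_sup_inf_covers (F G : set (set X) -> \bar R) :
  (forall VV, finite_open_cover VV -> F VV = G VV) ->
  sup_inf_covers F = sup_inf_covers G.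
Proof.
move=> FG; congr ereal_sup; apply: eq_imagel => UU _ /=.
by congr ereal_inf; apply: eq_imagel => VV [cV _]; exact: FG.
Qed.

End SupInf.

Section Main.
Variables (R : realType) (Gamma : finGroupType) (X : metricType R).
Variable T : dynamical_system Gamma X.
Local Open Scope ereal_scope.

Definition max_ord (VV : set (set X)) : \bar R :=
  ereal_sup [set (cover_ord R VV x)%:E | x in [set: X]].

Definition max_orbit_ord (VV : set (set X)) : \bar R :=
  ereal_sup [set (\sum_(g : Gamma) cover_ord R VV (T g x))%:E | x in [set: X]].

Lemma sup_integral_cover_ord (VV : set (set X)) : [set: X] !=set0 ->
  finite_open_cover VV ->
  ereal_sup [set bp_integral mu (fun x => (cover_ord R VV x)%:E)
    | mu in invariant_probs R T] = (#|Gamma|%:R^-1)%:E * max_orbit_ord VV.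
Proof.
move=> [x0 _] cV; have G0 := card_group_gt0 R Gamma.
apply/eqP; rewrite eq_le; apply/andP; split.
  apply: ge_ereal_sup => _ [mu invmu <-].
  have le_max x :
      (\sum_(g : Gamma) cover_ord R VV (T g x))%:E <= max_orbit_ord VV.
    by apply: ereal_sup_ubound; exists x.
  case: (max_orbit_ord VV) le_max => [c| |] le_max.
  - apply: (bp_integral_le_orbit_sum invmu cV) => x.
    by have := le_max x; rewrite lee_fin.
  - by rewrite gt0_muley ?leey// lte_fin invr_gt0.
  - by have := le_max x0.
rewrite -ereal_sup_pZl ?invr_gt0//.
apply: ge_ereal_sup => _ [_ [x _ <-] <-].
rewrite -EFinM -bp_integral_orbit_prob//; apply: ereal_sup_ubound.
by exists (orbit_prob R T x) => //; exact: orbit_prob_invariant.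
Qed.

Lemma dyn_dimE : [set: X] !=set0 ->
  dyn_dim R T = (#|Gamma|%:R^-1)%:E * sup_inf_covers max_orbit_ord.
Proof.
move=> X0; rewrite /dyn_dim ifT; last first.
  apply/asboolP; have [x _] := X0; exists (orbit_prob R T x).
  exact: orbit_prob_invariant.
rewrite -sup_inf_covers_pZl ?invr_gt0 ?card_group_gt0//.
by apply: eq_sup_inf_covers => VV; exact: sup_integral_cover_ord.
Qed.

Lemma max_ord_le_orbit :
  sup_inf_covers max_ord <= sup_inf_covers max_orbit_ord.
Proof.
apply: le_sup_inf_covers => UU _ _ /cover_family[I [V [cV <- Vinj]]] VU.
have [J [P [cP PV mP]]] := @common_refinement R X _ I
  (fun g i => T g @^-1` V i) (enum Gamma)
  (fun g => open_cover_translates T g cV).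
exists (range P); split; first exact: finite_open_cover_range.
- move=> _ [j _ <-]; have [i Pi] := PV 1%g (mem_enum _ _) j.
  have [|U UU_U ViU] := VU (V i); first by exists i.
  by exists U => // x /Pi /=; rewrite act1 => /ViU.
- apply: ge_ereal_sup => _ [x _ <-]; apply: le_trans; last first.
    by apply: ereal_sup_ubound; exists x.
  rewrite lee_fin (le_trans (cover_ord_le R x cP))//.
  under eq_bigr do rewrite cover_ord_inj//.
  rewrite big_split/= sumr_const -natr_sum lerBlDr.
  rewrite mulNrn addrAC lerBrDr natr1 -natrD ler_nat -addn1.
  by have := mP x; rewrite -cardE big_enum.
Qed.

(** Orders are integers, so a value [r] of the right-hand side yields covers of
    order at most [Num.truncn r]. *)
Lemma orbit_le_max_ord : [set: X] !=set0 -> compact [set: X] -> free_system T ->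
  sup_inf_covers max_orbit_ord <= sup_inf_covers max_ord.
Proof.
move=> [x0 _] cX Tfree; apply: ge_ereal_sup => _ [UU cU <-].
have inf_le WW : finite_open_cover WW ->
    ereal_inf [set max_ord VV | VV in
      [set VV | finite_open_cover VV /\ refines VV WW]] <= sup_inf_covers max_ord.
  by move=> cW; apply: ereal_sup_ubound; exists WW.
have D0 : 0 <= sup_inf_covers max_ord.
  apply: le_trans (inf_le _ cU); apply: le_ereal_inf_tmp => _ [VV [cV _] <-].
  apply: le_ereal_sup_tmp; exists (cover_ord R VV x0)%:E; first by exists x0.
  by rewrite lee_fin cover_ord_ge0.
case: (sup_inf_covers max_ord) D0 inf_le => [r| |] // r0 inf_le; last first.
  exact: leey.
rewrite lee_fin in r0; have /andP[nr rn] := truncn_itv r0.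
have dimX : dim_le X (Num.truncn r).
  move=> I U /finite_open_cover_range cUr.
  have /ereal_inf_lt[_ [VV [/cover_family[J [V [cV <- Vinj]]] VU] <-] ltV] :
    ereal_inf [set max_ord VV | VV in
      [set VV | finite_open_cover VV /\ refines VV (range U)]]
      < (Num.truncn r).+1%:R%:E.
    by apply: le_lt_trans (inf_le _ cUr) _; rewrite lte_fin.
  exists J, V; split => // [j|x].
    by have [|_ [i _ <-] Vi] := VU (V j); [exists j|exists i].
  have : (cover_ord R (range V) x)%:E < (Num.truncn r).+1%:R%:E.
    by apply: le_lt_trans ltV; apply: ereal_sup_ubound; exists x.
  by rewrite lte_fin cover_ord_inj// ltrBlDr natr1 ltr_nat.
have [I [U [cUf UE _]]] := cover_family cU.
have [J [V [cV VU mV]]] := orbit_sum_cover Tfree cX dimX cUf.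
apply: le_trans (_ : max_orbit_ord (range V) <= _).
  apply: ereal_inf_lbound; exists (range V) => //; split.
    exact: finite_open_cover_range.
  move=> _ [j _ <-]; have [i Vi] := VU j.
  by exists (U i) => //; rewrite -UE; exists i.
apply: ge_ereal_sup => _ [x _ <-]; rewrite lee_fin (le_trans _ nr)//.
apply: (@le_trans _ _ (\sum_(g : Gamma) ((mult V (T g x))%:R - 1))%R).
  by apply: ler_sum => g _; exact: cover_ord_le.
rewrite big_split/= sumr_const -natr_sum mulNrn lerBlDr -natrD ler_nat.
exact: mV.
Qed.

End Main.

Theorem theorem7p1 (R : realType) (Gamma : finGroupType) (X : metricType R)
    (T : dynamical_system Gamma X) :
  compact [set: X]%classic ->
  free_system T ->
  dyn_dim R T = (((#|Gamma|%:R : R)^-1)%:E * covering_dim R X)%E.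
Proof.
move=> cX Tfree; have [X0|X0] := pselect ([set: X] !=set0).
  rewrite dyn_dimE// /covering_dim ifT; last exact/asboolP.
  congr (_ * _)%E; apply/eqP; rewrite eq_le max_ord_le_orbit.
  by rewrite orbit_le_max_ord.
rewrite /covering_dim ifF; last exact/asboolPn.
rewrite /dyn_dim ifF; last first.
  by apply/asboolPn => -[mu _]; apply: X0; exists (bp_base mu).
by rewrite gt0_muleNy// lte_fin invr_gt0 card_group_gt0.
Qed.
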